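(* Let $N\ge1$ be an integer and consider the discrete-time system $x(k+1)=f(k,x(k))$, where $f(k,\cdot):\mathbb{R}^n\to\mathbb{R}^n$ for each $k$. Let $\Omega_0\subset\mathbb{R}^n$ (the initial set) be closed, connected and bounded, and for $k=0,\dots,N$ let $\Omega^{\mathrm{tr}}_k\subset\mathbb{R}^n$ (the trajectory sets) be open, connected and bounded, with $\Omega_0\subset\Omega^{\mathrm{tr}}_0$. The system is finite-time stable with respect to $(\Omega_0,\Omega^{\mathrm{tr}}_k,N)$ if there exists a function $V:\{0,\dots,N\}\times\mathbb{R}^n\to\mathbb{R}$, continuous in $x$, such that $$dV(k,x)\le0\qquad\text{for all }x\in\Omega^{\mathrm{tr}}_k,\ k=0,\dots,N-1,$$ and $$\sup_{x\in\Omega_0}V(0,x)<\inf_{0\le k<N}\ \inf_{x\in\Omega^{fwd}_k}V(k+1,x).$$ Moreover, if $f(k,x)$ is continuous with respect to $x$ and admits an inverse $f^{-1}(k,x)$ (i.e. $f(k,\cdot)$ is invertible) for $k\in\{0,\dots,N\}$, then these conditions are also necessary, i.e. if the system is finite-time stable with respect to $(\Omega_0,\Omega^{\mathrm{tr}}_k,N)$ then such a $V$ exists.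
   Context: Finite-time stability: the system $x(k+1)=f(k,x(k))$ is FTS with respect to $(\Omega_0,\Omega^{\mathrm{tr}}_k,N)$ if and only if $x(0)\in\Omega_0$ implies $x(k)\in\Omega^{\mathrm{tr}}_k$ for $k=0,1,\dots,N$. Notation: $\bar\Omega$ and $\partial\Omega$ denote the closure and boundary of $\Omega$, and $f(k,\Omega)$ is the image of $\Omega$ under $f(k,\cdot)$. For $k=0,\dots,N-1$, $$\Omega^{fwd}_k:=\bigl[f(k,\bar\Omega^{\mathrm{tr}}_k)\setminus\Omega^{\mathrm{tr}}_{k+1}\bigr]\cup\partial f(k,\bar\Omega^{\mathrm{tr}}_k),\qquad dV(k,x):=V(k+1,f(k,x))-V(k,x).$$ *)

(* Defs.v *)
From HB Require Import structures.
From mathcomp Require Import all_boot all_order all_algebra.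
From mathcomp Require Import all_classical all_reals all_analysis.
Import Order.TTheory GRing.Theory Num.Theory numFieldNormedType.Exports.

Set Implicit Arguments.
Unset Strict Implicit.
Unset Printing Implicit Defensive.

Local Open Scope classical_set_scope.
Local Open Scope ring_scope.

(* Time-indexed data are total functions on [nat]; only the instants
   0, ..., N are ever constrained or used. *)

Definition boundary (T : topologicalType) (A : set T) : set T :=
  closure A `\` interior A.

Definition finite_time_stable (T : Type) (f : nat -> T -> T)
    (Omega0 : set T) (Omegatr : nat -> set T) (N : nat) : Prop :=
  forall x : nat -> T,
    (forall k, (k < N)%N -> x k.+1 = f k (x k)) ->
    Omega0 (x 0%N) -> forall k, (k <= N)%N -> Omegatr k (x k).

Definition Omegafwd (T : topologicalType) (f : nat -> T -> T)
    (Omegatr : nat -> set T) (k : nat) : set T :=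
  ((f k @` closure (Omegatr k)) `\` Omegatr k.+1)
    `|` boundary (f k @` closure (Omegatr k)).

Definition dV (R : realType) (T : Type) (f : nat -> T -> T)
    (V : nat -> T -> R) (k : nat) (x : T) : R :=
  V k.+1 (f k x) - V k x.

(* The supremum and infima are taken in the extended reals, so that
   sup set0 = -oo and inf set0 = +oo. *)
Definition lyapunov_conditions (R : realType) (T : topologicalType)
    (f : nat -> T -> T) (Omega0 : set T) (Omegatr : nat -> set T) (N : nat)
    (V : nat -> T -> R) : Prop :=
  [/\ forall k, (k <= N)%N -> continuous (V k),
      forall k x, (k < N)%N -> Omegatr k x -> dV f V k x <= 0
    & (ereal_sup [set (V 0%N x)%:E | x in Omega0]
       < ereal_inf [set ereal_inf [set (V k.+1 x)%:E | x in Omegafwd f Omegatr k]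
                   | k in [set k | (k < N)%N]])%E].

(* Main.v *)
(* Sufficiency: along a trajectory V is nonincreasing while it stays in the
   trajectory sets, and the first exit would take place in some Omegafwd.

   Necessity: take V constant along trajectories, i.e. transport by the inverse
   flow a Urysohn function separating Omega0 from the preimages of the sets
   Omegafwd under the flow.  These are disjoint because f(k, Omegatr k) is open
   and f(k, .)^-1 is continuous, which is invariance of domain.

   Invariance of domain follows Kulpa and Tao: were a point c near f 0 missed by
   the image of the unit cube, one could push that image radially away from c
   onto the complement of a small cube around c; a Lipschitz approximation of
   f^-1, shifted so as not to vanish on the boundary of this small cube, would
   then contradict the Poincare-Miranda theorem.  The latter is derived from a
   combinatorial statement on grids: if 0/1-valued labels F_i vanish on the
   faces y_i = 0 and equal 1 on the faces y_i = m, then on some unit cube every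
   F_i takes both values, since the cup product of the coboundaries dF_i, summed
   mod 2 over the grid, telescopes to 1. *)
Require Import Defs.
From mathcomp Require Import all_boot all_order all_algebra.
From mathcomp Require Import all_classical all_reals all_analysis.
From mathcomp Require Import lra ring.
Import Order.TTheory GRing.Theory Num.Theory numFieldNormedType.Exports.
Set Implicit Arguments.
Unset Strict Implicit.
Unset Printing Implicit Defensive.
Local Open Scope classical_set_scope.
Local Open Scope ring_scope.

(** * Cochains mod 2 on a cubical grid *)

Section CubicalSperner.
Variables (I : eqType) (F : I -> (I -> nat) -> bool).
Implicit Types (z : I -> nat) (s l : seq I).

Definition upd z j t : I -> nat := fun i => if i == j then t else z i.
Definition step z j := upd z j (z j).+1.
Definition del (j : I) s := [seq i <- s | i != j].

Lemma upd_id z j t : upd z j t j = t.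
Proof. by rewrite /upd eqxx. Qed.

Lemma upd_ne z j t i : i != j -> upd z j t i = z i.
Proof. by rewrite /upd => /negbTE ->. Qed.

Lemma updC z i j a b : i != j -> upd (upd z i a) j b = upd (upd z j b) i a.
Proof.
move=> ij; apply/funext => k; rewrite /upd.
by case: (eqVneq k j) => [->|//]; rewrite eq_sym (negbTE ij).
Qed.

Lemma step_ne z j i : i != j -> step z j i = z i.
Proof. exact: upd_ne. Qed.

Lemma upd_upd z j a b : upd (upd z j a) j b = upd z j b.
Proof. by apply/funext => k; rewrite /upd; case: (k == j). Qed.

Lemma stepC z i j : step (step z i) j = step (step z j) i.
Proof.
have [->//|ij] := eqVneq i j.
by rewrite {1}/step step_ne 1?eq_sym// [RHS]/step step_ne// {1}/step updC.
Qed.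

Lemma delC i j s : del i (del j s) = del j (del i s).
Proof. by rewrite /del -!filter_predI; apply: eq_filter => k /=; rewrite andbC. Qed.

Lemma mem_del i j s : (i \in del j s) = (i != j) && (i \in s).
Proof. by rewrite mem_filter. Qed.

Lemma del_notin j s : j \notin s -> del j s = s.
Proof.
by move=> js; apply/all_filterP/allP => k ks; apply: contraNneq js => <-.
Qed.

(* The cup product dF_(i_1) u ... u dF_(i_r) of 0-cochains mod 2, evaluated on
   the unit cube with lowest vertex z and set of directions s.  Here bool is the
   field with two elements: + is exclusive or and * is conjunction. *)
Fixpoint cup l s z : bool :=
  if l is i :: l' then
    \sum_(j <- s) (F i (step z j) + F i z) * cup l' (del j s) (step z j)
  else s == [::].

(** The terms at [(j, k)] and [(k, j)] are equal, so they cancel mod 2. *)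
Lemma sum_sym_offdiag s (g : I -> I -> bool) : (forall i j, g i j = g j i) ->
  \sum_(j <- s) \sum_(k <- s | k != j) g j k = 0.
Proof.
move=> gC; elim: s => [|a s IH]; first by rewrite big_nil.
rewrite big_cons big_cons eqxx/=.
under [X in _ + X]eq_bigr do rewrite big_cons.
have -> : \sum_(j <- s) (if a != j then g j a + \sum_(k <- s | k != j) g j k
     else \sum_(k <- s | k != j) g j k) =
   \sum_(j <- s | j != a) g j a + \sum_(j <- s) \sum_(k <- s | k != j) g j k.
  rewrite [X in _ = X + _]big_mkcond -big_split; apply: eq_bigr => j _ /=.
  by rewrite eq_sym; case: eqP => //= _; rewrite add0r.
rewrite IH addr0; under [X in _ + X]eq_bigr do rewrite gC.
exact: addbb.
Qed.

(** A cup product of coboundaries is a cocycle. By induction on [l], the factors [cup l] coming from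
    the lower facets can be moved to the vertex [step (step z j) k]; the resulting summand is
    symmetric in [j] and [k]. *)
Lemma cup_closed l s z :
  \sum_(j <- s) (cup l (del j s) (step z j) + cup l (del j s) z) = 0.
Proof.
elim: l s z => [|i l IH] s z /=.
  by rewrite big1// => j _; exact: addbb.
rewrite big_split/=.
pose W j k := cup l (del k (del j s)) (step (step z j) k).
have WC j k : W j k = W k j by rewrite /W delC stepC.
have e2 : \sum_(j <- s) \sum_(k <- del j s)
      (F i (step z k) + F i z) * cup l (del k (del j s)) (step z k)
    = \sum_(j <- s) \sum_(k <- s | k != j) (F i (step z k) + F i z) * W j k.
  under eq_bigr do rewrite big_filter big_mkcond.
  rewrite exchange_big/=.
  under [RHS]eq_bigr do rewrite big_mkcond.
  rewrite [RHS]exchange_big/=; apply: eq_bigr => k _.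
  under eq_bigr do rewrite eq_sym.
  under [RHS]eq_bigr do rewrite eq_sym.
  rewrite -!big_mkcond/= -!mulr_sumr; congr (_ * _).
  under eq_bigr do rewrite delC.
  under [RHS]eq_bigr do rewrite WC.
  rewrite -[LHS]big_filter -[RHS]big_filter.
  have := IH (del k s) (step z k); rewrite big_split/= /W => /eqP.
  by rewrite addr_eq0 => /eqP ->.
rewrite e2; under eq_bigr do rewrite big_filter.
rewrite -big_split/=; under eq_bigr do rewrite -big_split/=.
under eq_bigr do under eq_bigr do rewrite -/(W _ _) -mulrDl.
apply: sum_sym_offdiag => j k; rewrite WC stepC; congr (_ * _).
by case: (F i (step z j)); case: (F i (step z k));
  case: (F i (step (step z k) j)); case: (F i z).
Qed.

(** Leibniz rule: dF u c = d(F u c) when dc = 0, here with c the cocycle [cup l]. *)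
Lemma cup_consE i l s z : cup (i :: l) s z =
  \sum_(j <- s) (F i (step z j) * cup l (del j s) (step z j)
                 + F i z * cup l (del j s) z).
Proof.
rewrite big_split/= -mulr_sumr.
have := cup_closed l s z; rewrite big_split/= => /eqP.
rewrite addr_eq0 => /eqP => e.
have -> : \sum_(j <- s) cup l (del j s) z = \sum_(j <- s) cup l (del j s) (step z j).
  by rewrite e.
by rewrite mulr_sumr -big_split/=; apply: eq_bigr => j _; rewrite mulrDl.
Qed.

Variable m : nat.
Hypothesis F0 : forall i z, z i = 0%N -> F i z = false.
Hypothesis Fm : forall i z, z i = m -> F i z = true.

Fixpoint box s (g : (I -> nat) -> bool) z : bool :=
  if s is j :: s' then \sum_(t < m) box s' g (upd z j t) else g z.

Lemma box_sum (J : Type) (r : seq J) s (g : J -> (I -> nat) -> bool) z :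
  box s (fun y => \sum_(j <- r) g j y) z = \sum_(j <- r) box s (g j) z.
Proof.
elim: s z => [//|i s IH] z /=; rewrite [RHS]exchange_big/=.
by apply: eq_bigr => t _; rewrite IH.
Qed.

Lemma box_add s (g h : (I -> nat) -> bool) z :
  box s (fun y => g y + h y) z = box s g z + box s h z.
Proof.
elim: s z => [//|i s IH] z /=; rewrite -big_split/=.
by apply: eq_bigr => t _; rewrite IH.
Qed.

Lemma eq_box s g h z :
  (forall y, {in predC (mem s), y =1 z} -> {in s, forall i, (y i < m)%N} ->
     g y = h y) -> box s g z = box s h z.
Proof.
elim: s z => [|i s IH] z gh /=; first exact: gh.
apply: eq_bigr => t _; apply: IH => y ys ysm; apply: gh => j.
  rewrite !inE negb_or => /andP[ji js].
  by rewrite ys ?upd_ne.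
rewrite inE => /orP[/eqP ->|]; last exact: ysm.
have [/ysm//|ins] := boolP (i \in s).
by rewrite ys// upd_id.
Qed.

Lemma box0 s z : box s (fun=> false) z = false.
Proof. by elim: s z => [//|i s IH] z /=; rewrite big1. Qed.

Lemma box_upd s g z j t : j \notin s ->
  box s g (upd z j t) = box s (fun y => g (upd y j t)) z.
Proof.
elim: s z => [//|i s IH] z /=; rewrite inE negb_or => /andP[ji js].
by apply: eq_bigr => a _; rewrite updC// IH.
Qed.

Lemma box_telescope s g z j : uniq s -> j \in s ->
  box s (fun y => g (step y j) + g y) z =
  box (del j s) g (upd z j m) + box (del j s) g (upd z j 0%N).
Proof.
elim: s z => [//|i s IH] z /= /andP[ins us]; rewrite inE.
have [->|ij] := eqVneq j i => /= js.
  rewrite del_notin//.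
  (* Subtraction in [bool] coincides with addition, which puts the sum in telescoping form. *)
  have -> : \sum_(t < m) box s (fun y => g (step y i) + g y) (upd z i t) =
      \sum_(t < m) (box s g (upd z i t.+1) - box s g (upd z i t)).
    apply: eq_bigr => t _; rewrite box_add; congr (_ + _).
    rewrite box_upd// [RHS]box_upd//; apply: eq_box => y _ _.
    by rewrite /step upd_id upd_upd.
  by rewrite -(big_mkord xpredT
    (fun t => box s g (upd z i t.+1) - box s g (upd z i t))) telescope_sumr.
rewrite -big_split/=; apply: eq_bigr => t _.
by rewrite IH// updC 1?eq_sym// [in X in _ + X]updC 1?eq_sym.
Qed.

(** [F j] is constant on each of the two extreme faces, so its coboundary vanishes on every edge of
    a cube lying in such a face. *)
Lemma cup_face l s z j : j \in l -> j \notin s ->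
  (z j == 0%N) || (z j == m) -> cup l s z = false.
Proof.
move=> + + jm; elim: l s z jm => [//|i l IH] s z jm; rewrite inE => jl js /=.
rewrite big_seq big1// => k ks.
have jk : j != k by apply: contraNneq js => ->.
have [ji|/= ij] := eqVneq j i.
  subst i.
  suff -> : F j (step z k) = F j z by rewrite [X in X * _]addbb mul0r.
  case/orP: jm => /eqP jm; first by rewrite !F0// step_ne.
  by rewrite !Fm// step_ne.
rewrite IH ?mulr0//; first by rewrite step_ne.
  by move: jl; rewrite (negbTE ij).
by rewrite mem_del negb_and js orbT.
Qed.

(** Stokes: the summand is a coboundary by [cup_consE], so its sum reduces to the faces of the grid.
    Faces in a direction of [l] vanish by [cup_face], and the face where coordinate [i] is 0 by
    [F0]. On the face where it is [m], [F i] is 1 and induction applies. *)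
Lemma box_cup l z : uniq l -> box l (cup l l) z = true.
Proof.
elim: l z => [//|i l IH] z /= /andP[il ul].
transitivity (box (i :: l) (cup (i :: l) (i :: l)) z); first by [].
rewrite (@eq_box _ _ (fun z => \sum_(j <- i :: l)
  (F i (step z j) * cup l (del j (i :: l)) (step z j)
                 + F i z * cup l (del j (i :: l)) z))); last first.
  by move=> y _ _; exact: cup_consE.
rewrite box_sum.
transitivity (\sum_(j <- i :: l) (j == i)); last first.
  rewrite big_cons eqxx big_seq big1 ?addr0// => j jl.
  by apply: contraNF il => /eqP <-.
rewrite big_seq [RHS]big_seq; apply: eq_bigr => j jil.
rewrite (@box_telescope _ (fun z => F i z * cup l (del j (i :: l)) z))//; last first.
  by rewrite /= il.
have [->|ji] := eqVneq j i.
  rewrite /del/= eqxx/= -/(del i l) del_notin//.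
  have -> : box l (fun y => F i y * cup l l y) (upd z i m) = box l (cup l l) (upd z i m).
    apply: eq_box => y ys _; rewrite Fm ?mul1r//.
    by rewrite ys ?inE// upd_id.
  rewrite IH//.
  rewrite (@eq_box _ _ (fun=> false)) ?box0// => y ys _.
  by rewrite F0 ?mul0r// ys ?inE// upd_id.
have jl : j \in l by move: jil; rewrite inE (negbTE ji).
have H c : (c == 0%N) || (c == m) ->
   box (del j (i :: l)) (fun y => F i y * cup l (del j (i :: l)) y) (upd z j c) = false.
  move=> c0; have nj : j \notin del j (i :: l) by rewrite mem_del eqxx.
  rewrite (@eq_box _ _ (fun=> false)) ?box0// => y ys _.
  by rewrite (@cup_face _ _ _ j) ?mulr0// ys ?inE// upd_id.
transitivity (false + false : bool) => //.
by congr (_ + _); apply: H; rewrite eqxx ?orbT.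
Qed.

Definition in_cube z s y := forall i, (z i <= y i <= z i + (i \in s))%N.

Lemma in_cube_step z s j y : j \in s -> in_cube (step z j) (del j s) y ->
  in_cube z s y.
Proof.
move=> js H i; have := H i; rewrite mem_del.
have [->|ij] := eqVneq i j; last by rewrite step_ne.
by rewrite /step upd_id js addn0 addn1 => /andP[/ltnW -> ->].
Qed.

Lemma in_cube_id z s : in_cube z s z.
Proof. by move=> i; rewrite leqnn leq_addr. Qed.

(** A nonzero sum has a nonzero term: its first factor says that [F k] changes along an edge at [z],
    and its second one yields the remaining labels inside the upper facet. *)
Lemma cup_neq0 l s z i : cup l s z -> i \in l ->
  exists p q, [/\ in_cube z s p, in_cube z s q, ~~ F i p & F i q].
Proof.
elim: l s z => [//|k l IH] s z C; rewrite inE => il.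
have [j js Cj] : exists2 j, j \in s &
    (F k (step z j) + F k z) * cup l (del j s) (step z j).
  apply: contrapT => nj; move: C => /=; rewrite big_seq big1// => j js.
  by apply/negbTE/negP => ?; apply: nj; exists j.
have {Cj} [Dk Cl] := andP Cj.
have zj : in_cube z s (step z j).
  by apply: (in_cube_step js); exact: in_cube_id.
have zz := in_cube_id z s.
have [e|ik] := eqVneq i k.
  subst i; move: Dk; case E1: (F k (step z j)); case E2: (F k z) => //= _.
    by exists z, (step z j); rewrite E1 E2.
  by exists (step z j), z; rewrite E1 E2.
have {}il : i \in l by move: il; rewrite (negbTE ik).
have [p [q [Hp Hq ? ?]]] := IH _ _ Cl il.
by exists p, q; split => //; exact: in_cube_step js _.
Qed.

Lemma cubical_sperner l : uniq l -> exists z, {in l, forall i, (z i < m)%N} /\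
  forall i, i \in l ->
  exists p q, [/\ in_cube z l p, in_cube z l q, ~~ F i p & F i q].
Proof.
move=> ul; apply: contrapT => H.
have := box_cup (fun=> 0%N) ul.
rewrite (@eq_box _ _ (fun=> false)) ?box0// => y _ ym.
apply/negbTE/negP => C; apply: H; exists y; split => // i il.
exact: cup_neq0 C il.
Qed.

End CubicalSperner.

(** * The max norm and uniform estimates on compact sets *)

Section MaxNorm.
Context {R : realType} {n : nat}.
Implicit Types (x y : 'rV[R]_n) (K : set 'rV[R]_n).

Lemma le_rV_norm x e : 0 <= e -> (`|x| <= e) <-> (forall i, `|x 0 i| <= e).
Proof.
move=> e0; rewrite [`|x|]/Num.norm/= mx_normrE; split.
  by move=> /bigmax_leP[_ H] i; exact: (H (0, i)).
by move=> H; apply/bigmax_leP; split => // -[a i] _ /=; rewrite (ord1 a).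
Qed.

Lemma lt_rV_norm x e : 0 < e -> (`|x| < e) <-> (forall i, `|x 0 i| < e).
Proof.
move=> e0; rewrite [`|x|]/Num.norm/= mx_normrE; split.
  by move=> /bigmax_ltP[_ H] i; exact: (H (0, i)).
by move=> H; apply/bigmax_ltP; split => // -[a i] _ /=; rewrite (ord1 a).
Qed.

Lemma coord_le_norm x i : `|x 0 i| <= `|x|.
Proof. exact: (le_rV_norm x (normr_ge0 x)).1. Qed.

Lemma compact_cube : compact [set x : 'rV[R]_n | `|x| <= 1].
Proof.
apply: bounded_closed_compact.
  by exists 1; split => // M M1 x /= x1; apply: le_trans x1 (ltW M1).
apply: (@preimage_closed _ _ (fun x : 'rV[R]_n => `|x|) [set t : R | t <= 1]).
  by move=> x _; exact: norm_continuous.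
exact: closed_le.
Qed.

(** [d] is the minimum of [p] on the compact set where [q] is at least [e], positive because a zero
    of [p] is a zero of [q]. Taking for [p] and [q] the distances of points and of their images, in
    either order, gives uniform continuity and uniform injectivity. *)
Lemma compact_modulus K (p q : 'rV[R]_n * 'rV[R]_n -> R) : compact K ->
  continuous p -> continuous q ->
  (forall u, 0 <= p u) -> (forall u, p u = 0 -> q u = 0) ->
  forall e, 0 < e -> exists2 d, 0 < d &
    forall x y, K x -> K y -> p (x, y) < d -> q (x, y) < e.
Proof.
move=> cK cp cq p0 pq e e0.
pose S := (K `*` K) `&` [set u | e <= q u].
have cS : compact S.
  apply: compact_closedI; first exact: compact_setX.
  apply: (@preimage_closed _ _ q [set t : R | e <= t]).
    by move=> x _; exact: cq.
  exact: closed_ge.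
have [S0|/set0P S0] := eqVneq S set0.
  exists 1 => // x y Kx Ky _; rewrite ltNge; apply/negP => qe.
  by have : S (x, y) by []; rewrite S0.
have [c Sc mc] := compact_EVT_min S0 cS (continuous_subspaceT cp).
have qc : e <= q c by move: Sc; rewrite inE => -[].
exists (p c).
  rewrite lt_neqAle p0 andbT eq_sym; apply/eqP => /pq q0.
  by move: qc; rewrite q0 leNgt e0.
move=> x y Kx Ky pxy; rewrite ltNge; apply/negP => qe.
have Sxy : (x, y) \in S by rewrite inE.
by have := mc _ Sxy; rewrite leNgt pxy.
Qed.

Lemma dist_continuous (f : 'rV[R]_n -> 'rV[R]_n) : continuous f ->
  continuous (fun u : 'rV[R]_n * 'rV[R]_n => `|f u.1 - f u.2|).
Proof.
move=> cf u; apply: cvg_norm; apply: cvgB.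
  by apply: (@cvg_comp _ _ _ fst f _ (nbhs u.1)); [exact: cvg_fst | exact: cf].
by apply: (@cvg_comp _ _ _ snd f _ (nbhs u.2)); [exact: cvg_snd | exact: cf].
Qed.

Lemma compact_uniform_continuous K (f : 'rV[R]_n -> 'rV[R]_n) :
  compact K -> continuous f -> forall e, 0 < e -> exists2 d, 0 < d &
    forall x y, K x -> K y -> `|x - y| < d -> `|f x - f y| < e.
Proof.
move=> cK cf; apply: (@compact_modulus _ (fun u => `|u.1 - u.2|)
  (fun u => `|f u.1 - f u.2|) cK) => //.
- exact: (dist_continuous (fun x => cvg_id)).
- exact: dist_continuous.
- by move=> u /eqP; rewrite normr_eq0 subr_eq0 => /eqP ->; rewrite subrr normr0.
Qed.

Lemma compact_uniform_injective K (f : 'rV[R]_n -> 'rV[R]_n) :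
  compact K -> continuous f -> injective f ->
  forall e, 0 < e -> exists2 d, 0 < d &
    forall x y, K x -> K y -> `|f x - f y| < d -> `|x - y| < e.
Proof.
move=> cK cf fI; apply: (@compact_modulus _ (fun u => `|f u.1 - f u.2|)
  (fun u => `|u.1 - u.2|) cK) => //.
- exact: dist_continuous.
- exact: (dist_continuous (fun x => cvg_id)).
- move=> u /eqP; rewrite normr_eq0 subr_eq0 => /eqP/fI ->.
  by rewrite subrr normr0.
Qed.

End MaxNorm.

(** * The Poincare-Miranda theorem *)

Section PoincareMiranda.
Context {R : realType} {n : nat}.

Lemma poincare_miranda (H : 'rV[R]_n -> 'rV[R]_n) : continuous H ->
  (forall (x : 'rV[R]_n) i, `|x| <= 1 -> x 0 i = -1 -> H x 0 i <= 0) ->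
  (forall (x : 'rV[R]_n) i, `|x| <= 1 -> x 0 i = 1 -> 0 <= H x 0 i) ->
  exists2 x : 'rV[R]_n, `|x| <= 1 & H x = 0.
Proof.
move=> cH Hm Hp; apply: contrapT => noz.
have cB := @compact_cube R n.
have [c Bc mc] : exists2 c : 'rV[R]_n, c \in [set x | `|x| <= 1] &
    forall x, x \in [set x | `|x| <= 1] -> `|H c| <= `|H x|.
  apply: (@compact_EVT_min _ _ (fun x => `|H x|)) => //.
    by exists 0; rewrite /= normr0.
  have cN : continuous (fun x : 'rV[R]_n => `|H x|).
    move=> x; apply: (@continuous_comp _ _ _ H Num.norm); first exact: cH.
    exact: norm_continuous.
  exact: continuous_subspaceT cN.
(* Without a zero this minimum is positive; the grid will provide a point of the cube where the norm
   of [H] is smaller. *)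
set eta := `|H c| in mc.
have eta0 : 0 < eta.
  rewrite normr_gt0; apply/eqP => Hc; apply: noz; exists c => //.
  by rewrite inE in Bc.
have [d d0 dH] := compact_uniform_continuous cB cH eta0.
(* The mesh [2 / m] is below the modulus [d], so [H] varies by less than [eta] on a grid cell. *)
pose m := (Num.truncn (2 / d)).+1.
have m0 : 0 < m%:R :> R by rewrite ltr0n.
have md : 2 / m%:R < d.
  by rewrite ltr_pdivrMr// mulrC -ltr_pdivrMr//; exact: truncnS_gt.
pose pt (y : 'I_n -> nat) : 'rV[R]_n := \row_i (-1 + 2 / m%:R * (y i)%:R).
(* The label is the sign of a component of [H]. Its values at 0 and [m] are forced, because the face
   conditions must hold for all [y], even those with [pt y] outside the cube. *)
pose F i y := (y i != 0%N) && ((y i == m) || (0 <= H (pt y) 0 i)).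
have ptB y : (forall i, y i <= m)%N -> `|pt y| <= 1.
  move=> ym; apply/le_rV_norm => // i; rewrite mxE ler_norml.
  have : 2 / m%:R * (y i)%:R <= 2 :> R.
    by rewrite mulrAC ler_pdivrMr// ler_wpM2l// ler_nat.
  have : 0 <= 2 / m%:R * (y i)%:R :> R by rewrite mulr_ge0// divr_ge0// ltW.
  by move=> ? ?; apply/andP; split; lra.
have [||z [zm Hz]] := @cubical_sperner _ F m _ _ (enum 'I_n) (enum_uniq _).
- by move=> i y y0; rewrite /F y0.
- by move=> i y ym; rewrite /F ym eqxx.
have {}zm i : (z i < m)%N by apply: zm; rewrite mem_enum.
have near_z y : in_cube z (enum 'I_n) y -> `|pt y| <= 1 /\ `|H (pt z) - H (pt y)| < eta.
  move=> Hy; have yB : `|pt y| <= 1.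
    apply: ptB => i; have := Hy i; rewrite mem_enum addn1 => /andP[_ yz].
    exact: leq_trans yz (zm i).
  have zB : `|pt z| <= 1 by apply: ptB => i; exact: ltnW.
  split => //; apply: dH => //=.
  apply: le_lt_trans md; apply/le_rV_norm; first by rewrite divr_ge0// ltW.
  move=> i; rewrite !mxE.
  have -> : -1 + 2 / m%:R * (z i)%:R - (-1 + 2 / m%:R * (y i)%:R) =
    2 / m%:R * ((z i)%:R - (y i)%:R) :> R by ring.
  have s0 : 0 <= 2 / m%:R :> R by rewrite divr_ge0// ltW.
  rewrite normrM (ger0_norm s0) -[leRHS]mulr1 ler_wpM2l//.
  have := Hy i; rewrite mem_enum => /andP[zy yz].
  rewrite distrC -natrB// ger0_norm// -[leRHS]/(1%:R) ler_nat.
  by rewrite leq_subLR.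
(* Component [i] of [H] is nonpositive at [pt p] and nonnegative at [pt q], and both values are
   within [eta] of the one at [pt z]. *)
have : `|H (pt z)| < eta.
  apply/lt_rV_norm => // i.
  have [p [q [/near_z[pB pz] /near_z[qB qz] Fp Fq]]] := Hz i (mem_enum _ i).
  have Hp0 : H (pt p) 0 i <= 0.
    move: Fp; rewrite /F negb_and negbK negb_or => /orP[/eqP p0|/andP[_]].
      by apply: Hm => //; rewrite mxE p0 mulr0 addr0.
    by rewrite -ltNge => /ltW.
  have Hq0 : 0 <= H (pt q) 0 i.
    move: Fq => /andP[_ /orP[/eqP qm|//]].
    by apply: Hp => //; rewrite mxE qm mulfVK ?gt_eqF//; ring.
  have := le_lt_trans (coord_le_norm _ i) pz.
  have := le_lt_trans (coord_le_norm _ i) qz.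
  rewrite !mxE !ltr_norml => /andP[a1 a2] /andP[b1 b2].
  by apply/andP; split; lra.
rewrite ltNge mc// inE/=; apply: ptB => i; exact: ltnW.
Qed.

End PoincareMiranda.

(** * Invariance of domain *)

Section InvarianceOfDomain.
Context {R : realType}.

Lemma same_trunc_dist (u w : R) : 0 <= u -> 0 <= w ->
  Num.truncn u = Num.truncn w -> `|u - w| < 1.
Proof.
move=> /truncn_itv/andP[u1 u2] /truncn_itv/andP[w1 w2] e.
rewrite e in u1 u2; move: u2 w2; rewrite -natr1 => u2 w2.
by rewrite ltr_norml; apply/andP; split; lra.
Qed.

Lemma natr_dist_lt1 (a b : nat) : `|a%:R - b%:R : R| < 1 -> a = b.
Proof.
rewrite ltr_norml => /andP[h1 h2].
apply/eqP; rewrite eqn_leq; apply/andP.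
by split; rewrite -ltnS -(ltr_nat R) -[_.+1%:R]natr1; lra.
Qed.

(** A counting form of the fact that a Lipschitz map sends an n-dimensional set to a null set.
    Otherwise each of M^(n+1) well-separated vectors [v a] has a preimage on the cube boundary. That
    boundary is covered by 2(n+1)(m+1)^n cells too small to contain preimages of two of them, which
    is fewer cells than vectors. *)
Lemma lipschitz_avoids_near0 n (P : 'rV[R]_n.+1 -> 'rV[R]_n.+1) (L : R) :
  0 <= L -> (forall y z, `|P y - P z| <= L * `|y - z|) ->
  forall c e d, 0 < e -> 0 < d ->
  exists2 v, `|v| < d & forall y, `|y - c| = e -> P y <> v.
Proof.
move=> L0 LP c e d e0 d0; apply: contrapT => nv.
have {}nv v : `|v| < d -> exists yi : 'rV[R]_n.+1 * 'I_n.+1,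
    [/\ `|yi.1 - c| = e, `|(yi.1 - c) 0 yi.2| = e & P yi.1 = v].
  move=> vd; apply: contrapT => H; apply: nv; exists v => // y yc Py.
  have : ~ (`|y - c| < e) by rewrite yc ltxx.
  apply; apply/lt_rV_norm => // i; rewrite lt_neqAle -{2}yc coord_le_norm andbT.
  by apply/eqP => yi; apply: H; exists (y, i).
(* [q] makes the variation [L * r] of [P] on a cell smaller than the separation [d / 2 / M]; [M] is
   chosen to win the final count, where [m.+1] is at most [q.+1 * M]. *)
pose q := (Num.truncn (4 * L * e / d)).+1.
have q_gt : 4 * L * e / d < q%:R := truncnS_gt _.
pose M := (2 * n.+1 * q.+1 ^ n).+1.
pose m := (q * M)%N.
have M0 : 0 < M%:R :> R by rewrite ltr0n.
have m0 : 0 < m%:R :> R by rewrite ltr0n muln_gt0.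
pose r : R := 2 * e / m%:R.
have r0 : 0 < r by rewrite divr_gt0// mulr_gt0.
have Lr : L * r < d / 2 / M%:R.
  have -> : L * r = (4 * L * e / d) * (d / 2 / m%:R).
    by rewrite /r; field; rewrite !gt_eqF.
  rewrite /m natrM.
  have -> : d / 2 / M%:R = q%:R * (d / 2 / (q%:R * M%:R)).
    by field; rewrite !gt_eqF// ltr0n.
  by rewrite ltr_pM2r// !divr_gt0// mulr_gt0// ltr0n.
pose v (a : {ffun 'I_n.+1 -> 'I_M}) : 'rV[R]_n.+1 :=
  \row_i (d / 2 / M%:R * (a i)%:R).
have vd a : `|v a| < d.
  apply/lt_rV_norm => // i; rewrite mxE ger0_norm; last first.
    by rewrite mulr_ge0// !divr_ge0// ltW.
  apply: (@lt_trans _ _ (d / 2)); last by rewrite ltr_pdivrMr//; lra.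
  by rewrite mulrAC ltr_pdivrMr// ltr_pM2l ?divr_gt0// ltr_nat.
have v_sep a b : `|v a - v b| < d / 2 / M%:R -> a = b.
  have s0 : 0 < d / 2 / M%:R by rewrite !divr_gt0.
  move=> /(lt_rV_norm _ s0) vab; apply/ffunP => i; apply/val_inj => /=.
  have := vab i; rewrite !mxE -mulrBr normrM gtr0_norm// gtr_pMr//.
  exact: natr_dist_lt1.
have [Y HY] := choice (fun a => nv _ (vd a)).
pose cell a k := Num.truncn ((((Y a).1 - c) 0 k + e) / r).
have Yk a k : 0 <= ((Y a).1 - c) 0 k + e <= 2 * e.
  have [Ye _ _] := HY a; have := coord_le_norm ((Y a).1 - c) k; rewrite Ye ler_norml.
  by move=> /andP[? ?]; apply/andP; split; lra.
have Y0 a k : 0 <= (((Y a).1 - c) 0 k + e) / r.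
  by rewrite divr_ge0 ?(ltW r0)//; have /andP[] := Yk a k.
have cell_lt a k : (cell a k < m.+1)%N.
  rewrite ltnS truncn_le_nat.
  apply: (@le_lt_trans _ _ m%:R); last by rewrite ltr_nat.
  rewrite ler_pdivrMr// /r mulrCA mulfV ?gt_eqF// mulr1.
  by have /andP[] := Yk a k.
(* The face containing the point, as a direction and a sign, and the cell of the [n] other
   coordinates. The value [m] is reached at the far end [2 * e], whence [m.+1] cells. *)
pose code a : 'I_n.+1 * bool * {ffun 'I_n -> 'I_m.+1} :=
  ((Y a).2, 0 <= ((Y a).1 - c) 0 (Y a).2,
   [ffun k => Ordinal (cell_lt a (lift (Y a).2 k))]).
have code_inj : injective code.
  move=> a b [ei es /ffunP ef].
  apply: v_sep; have [_ ya <-] := HY a.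
  have [_ yb <-] := HY b.
  apply: le_lt_trans (LP _ _) _; apply: le_lt_trans Lr.
  rewrite ler_wpM2l//; apply/le_rV_norm; first exact: ltW.
  move=> k.
  have -> : ((Y a).1 - (Y b).1) 0 k = ((Y a).1 - c) 0 k - ((Y b).1 - c) 0 k.
    by rewrite !mxE; ring.
  case: (unliftP (Y a).2 k) => [j ->|->].
    have := ef j; rewrite !ffunE => /(congr1 val)/=.
    rewrite -ei /cell => /(same_trunc_dist (Y0 _ _) (Y0 _ _)).
    rewrite -mulrBl normrM [`|r^-1|]gtr0_norm ?invr_gt0// ltr_pdivrMr// mul1r.
    by move=> /ltW; congr (`|_| <= _); ring.
  move: ya yb es; rewrite -ei => <-.
  case: (leP 0 _) => s1; case: (leP 0 _) => // s2.
    by rewrite (ger0_norm s1) (ger0_norm s2) => -> _; rewrite subrr normr0 ltW.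
  rewrite (ltr0_norm s1) (ltr0_norm s2) => /eqP; rewrite eqr_opp => /eqP -> _.
  by rewrite subrr normr0 ltW.
have := leq_card code code_inj.
rewrite !card_prod card_bool !card_ffun !card_ord leqNgt => /negP; apply.
have mq : (m.+1 ^ n <= (q.+1 * M) ^ n)%N.
  have [->//|n0] := posnP n.
  by rewrite leq_exp2r// mulSn addnC -addn1 leq_add2l.
apply: (@leq_ltn_trans (n.+1 * 2 * (q.+1 * M) ^ n)%N); first by rewrite leq_mul2l mq orbT.
rewrite expnMn mulnA [(n.+1 * 2)%N]mulnC expnSr [X in (_ < X)%N]mulnC.
by rewrite ltn_pmul2r ?expn_gt0// ltnSn.
Qed.

(** Inf-convolution as in McShane's extension: coordinate [i] of [P y] is the infimum of
    [x 0 i + L * |y - f x|] over the cube, hence [L]-Lipschitz. With [L = 2 / s], points whose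
    images are at least [s] apart pay a penalty of at least 2, the width of the cube; the others are
    [d]-close by uniform injectivity. *)
Lemma lipschitz_approx_inverse n (f : 'rV[R]_n -> 'rV[R]_n) d :
  continuous f -> injective f -> 0 < d ->
  exists P : 'rV[R]_n -> 'rV[R]_n, exists2 L : R, 0 <= L &
    (forall y z, `|P y - P z| <= L * `|y - z|) /\
    (forall x : 'rV[R]_n, `|x| <= 1 -> `|P (f x) - x| <= d).
Proof.
move=> cf fI d0.
have [s s0 fs] := compact_uniform_injective (@compact_cube R n) cf fI d0.
pose L := 2 / s.
have L0 : 0 <= L by rewrite divr_ge0// ltW.
pose S i y := [set x 0 i + L * `|y - f x| | x in [set x : 'rV[R]_n | `|x| <= 1]].
have S0 i y : S i y !=set0.
  by exists ((0 : 'rV[R]_n) 0 i + L * `|y - f 0|), 0 => //=; rewrite normr0.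
have lbS i y : has_lbound (S i y).
  exists (-1) => _ [x /= x1 <-].
  have := le_trans (coord_le_norm x i) x1; rewrite ler_norml => /andP[x1i _].
  by apply: le_trans x1i _; rewrite lerDl mulr_ge0.
have S_le i y (x : 'rV[R]_n) : `|x| <= 1 -> inf (S i y) <= x 0 i + L * `|y - f x|.
  by move=> x1; apply: ge_inf => //; exists x.
have Slip i y z : inf (S i y) - inf (S i z) <= L * `|y - z|.
  rewrite lerBlDr addrC -lerBlDr; apply: lb_le_inf => // _ [x /= x1 <-].
  rewrite lerBlDr; apply: le_trans (S_le i y x x1) _.
  by rewrite -addrA lerD2l -mulrDr ler_wpM2l// [leRHS]addrC ler_distD.
exists (fun y => \row_i inf (S i y)), L => //; split.
  move=> y z; apply/le_rV_norm; first by rewrite mulr_ge0.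
  move=> i; rewrite !mxE ler_norml Slip andbT lerNl opprB distrC.
  exact: Slip.
move=> x x1; apply/le_rV_norm; first exact: ltW.
move=> i; rewrite !mxE distrC ler_norml; apply/andP; split; last first.
  rewrite lerBlDr -lerBlDl; apply: lb_le_inf => // _ [z /= z1 <-].
  have [fxz|fxz] := ltP (`|f x - f z|) s.
    have := le_lt_trans (coord_le_norm (x - z) i) (fs _ _ x1 z1 fxz).
    rewrite !mxE ltr_norml => /andP[_ h].
    have Lf : 0 <= L * `|f x - f z| by rewrite mulr_ge0.
    by move: h; lra.
  have : 2 <= L * `|f x - f z| by rewrite /L mulrAC ler_pdivlMr// ler_pM2l.
  have := le_trans (coord_le_norm x i) x1; rewrite ler_norml => /andP[_ ?].
  have := le_trans (coord_le_norm z i) z1; rewrite ler_norml => /andP[? _].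
  by move=> ?; lra.
have := S_le i (f x) x x1; rewrite subrr normr0 mulr0 addr0 => h.
by move: h d0; clear; lra.
Qed.

Lemma lipschitz_cont n (P : 'rV[R]_n -> 'rV[R]_n) (L : R) : 0 <= L ->
  (forall y z, `|P y - P z| <= L * `|y - z|) -> continuous P.
Proof.
move=> L0 LP y; apply/(@cvgrPdist_lt _ _ _ (nbhs y)) => e e0.
have L1 : 0 < L + 1 by lra.
apply/nbhs_ballP; exists (e / (L + 1)); first by rewrite /= divr_gt0.
move=> z; rewrite -ball_normE /= ltr_pdivlMr// => yz.
apply: le_lt_trans (LP y z) _; apply: le_lt_trans yz.
by rewrite mulrC ler_wpM2l// lerDl.
Qed.

Lemma image_cube_nbhs n (f : 'rV[R]_n.+1 -> 'rV[R]_n.+1) :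
  continuous f -> injective f ->
  nbhs (f 0) (f @` [set x : 'rV[R]_n.+1 | `|x| <= 1]).
Proof.
move=> cf fI.
have cB := @compact_cube R n.+1.
have B0 : `|0 : 'rV[R]_n.+1| <= 1 by rewrite normr0.
have [s s0 fs] := compact_uniform_injective cB cf fI ltr01.
(* Boundary points of the unit cube have images at distance at least [s] from [f 0], hence at least
   [e] from any [c] within [e / 2] of [f 0]. *)
pose e := s / 2.
have e0 : 0 < e by rewrite divr_gt0.
have e20 : 0 < e / 2 by rewrite divr_gt0.
have [t t0 ft] : exists2 t, 0 < t & forall x : 'rV[R]_n.+1, `|x| < t -> `|f x - f 0| < e / 2.
  have /cvgrPdist_lt/(_ _ e20)/nbhs_ballP[t /= t0 Ht] := cf 0.
  exists t => // x xt; rewrite distrC; apply: Ht.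
  by rewrite -ball_normE /= sub0r normrN.
(* The bound 1/4 keeps the total error [2 * d] below 1 on the faces; [t / 2] makes any [x] of norm
   below [2 * d] satisfy the estimate [ft]. *)
pose d := Num.min (4^-1) (t / 2).
have d0 : 0 < d by rewrite lt_min invr_gt0 divr_gt0// ltr0n.
have d4 : d <= 4^-1 by rewrite ge_min lexx.
have dt : 2 * d <= t by rewrite mulrC -ler_pdivlMr// ge_min lexx orbT.
have [P [L L0 [LP Pf]]] := lipschitz_approx_inverse cf fI d0.
apply/nbhs_ballP; exists (e / 2) => // c; rewrite -ball_normE /= => fc.
apply: contrapT => Kc.
have [k k0 ck] : exists2 k, 0 < k & forall x : 'rV[R]_n.+1, `|x| <= 1 -> k <= `|f x - c|.
  have /compact_closed clK := continuous_compact (continuous_subspaceT cf) cB.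
  have /closed_openC oK := clK (@norm_hausdorff _ _).
  have /nbhs_ballP[k /= k0 Hk] : nbhs c (~` (f @` [set x : 'rV[R]_n.+1 | `|x| <= 1])).
    exact: open_nbhs_nbhs.
  exists k => // x x1; rewrite leNgt; apply/negP => xk.
  by apply: (Hk (f x)); [rewrite -ball_normE /= distrC | exists x].
have [v vd Pv] := lipschitz_avoids_near0 L0 LP c e0 d0.
(* The maximum with [k] only keeps the denominator positive, so that [push] is continuous
   everywhere; on the image of the cube [|y - c|] is at least [k] already. *)
pose push y := c + Num.max (e / Num.max k `|y - c|) 1 *: (y - c).
pose H x := P (push (f x)) - v.
have push_far x : e <= `|f x - c| -> push (f x) = f x.
  move=> xc; rewrite /push max_r ?scale1r ?subrKC//.
  rewrite ler_pdivrMr ?mul1r ?le_max ?xc ?orbT//.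
  by rewrite lt_max k0.
have cpush : continuous push.
  have csub : continuous (fun y : 'rV[R]_n.+1 => y - c).
    by move=> y; exact: (continuousB (@cvg_id _ (nbhs y)) (@cst_continuous _ _ c y)).
  have cnorm : continuous (fun y : 'rV[R]_n.+1 => Num.max k `|y - c|).
    move=> y; have cn : {for y, continuous (fun y : 'rV[R]_n.+1 => `|y - c|)}.
      exact: (continuous_comp (csub y) (@norm_continuous _ _ _)).
    exact: (@continuous_max R _ (cst k) _ y (@cst_continuous _ _ k y) cn).
  have cfac : continuous (fun y : 'rV[R]_n.+1 => Num.max (e / Num.max k `|y - c|) 1).
    move=> y.
    have cV : {for y, continuous (fun y : 'rV[R]_n.+1 => (Num.max k `|y - c|)^-1)}.
      by apply: continuousV; [rewrite gt_eqF// lt_max k0 | exact: cnorm].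
    have cM := continuousM (@cst_continuous _ _ e y) cV.
    exact: (@continuous_max R _ _ (cst 1) y cM (@cst_continuous _ _ _ y)).
  move=> y; have cZ := continuousZ (cfac y) (csub y).
  exact: (continuousD (@cst_continuous _ _ c y) cZ).
have cH : continuous H.
  move=> x; have cpf := continuous_comp (cf x) (cpush _).
  have cP : continuous P := lipschitz_cont L0 LP.
  have cPpf := continuous_comp cpf (cP _).
  exact: (continuousB cPpf (@cst_continuous _ _ v x)).
have face (x : 'rV[R]_n.+1) i b : `|x| <= 1 -> x 0 i = b -> `|b| = 1 -> `|H x 0 i - b| < 1.
  move=> x1 xi b1.
  have nx : `|x| = 1.
    by apply/eqP; rewrite eq_le x1 -b1 -xi coord_le_norm.
  have xfar : e <= `|f x - c|.
    have : s <= `|f x - f 0|.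
      by rewrite leNgt; apply/negP => /(fs _ _ x1 B0)/=; rewrite subr0 nx ltxx.
    have := ler_distD c (f x) (f 0); rewrite [`|c - _|]distrC.
    by move: fc; rewrite /e; lra.
  rewrite /H push_far// -xi.
  have := le_trans (coord_le_norm (P (f x) - x) i) (Pf x x1).
  have := le_lt_trans (coord_le_norm v i) vd.
  rewrite !mxE ler_norml !ltr_norml => /andP[? ?] /andP[? ?].
  by apply/andP; split; lra.
have [||x x1 Hx] := poincare_miranda cH.
- move=> x i x1 xi; have := face x i _ x1 xi; rewrite normrN normr1 => /(_ erefl).
  by rewrite ltr_norml => /andP[_]; lra.
- move=> x i x1 xi; have := face x i _ x1 xi; rewrite normr1 => /(_ erefl).
  by rewrite ltr_norml => /andP[+ _]; lra.
have {}Hx : P (push (f x)) = v by apply/eqP; rewrite -subr_eq0 -/(H x) Hx.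
(* If [f x] is nearer to [c] than [e], [push] sends it to distance exactly [e], where [P] avoids
   [v]. Otherwise [P (f x) = v] forces [x] to be so small that [f x] is nearer to [c] than [e] after
   all. *)
have [xe|xe] := leP e `|f x - c|; last first.
  apply: (Pv (push (f x))) => //.
  have fxc0 : 0 < `|f x - c| := lt_le_trans k0 (ck x x1).
  rewrite /push addrC addKr normrZ (max_r (ck x x1)) max_l; last first.
    by rewrite ler_pdivlMr// mul1r ltW.
  by rewrite ger0_norm ?divr_ge0 ?ltW// divfK ?gt_eqF.
have : `|x| < 2 * d.
  have := Pf x x1; rewrite -(push_far _ xe) Hx => vx.
  have := ler_normD v (x - v); rewrite subrKC distrC.
  by move: vx vd; lra.
move=> /lt_le_trans /(_ dt) /ft fx0.
have := ler_distD (f 0) (f x) c.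
by move: fx0 fc xe; lra.
Qed.

Lemma invariance_of_domain n (f : 'rV[R]_n -> 'rV[R]_n) :
  continuous f -> injective f -> forall U, open U -> open (f @` U).
Proof.
case: n f => [|n] f cf fI U oU.
  rewrite openE => _ [x Ux <-]; rewrite /interior.
  apply: filterS filterT => y _; exists x => //.
  by rewrite (thinmx0 (f x)) (thinmx0 y).
rewrite openE => _ [x Ux <-]; rewrite /interior.
have /nbhs_ballP[e /= e0 He] : nbhs x U by exact: open_nbhs_nbhs.
have e20 : 0 < e / 2 by rewrite divr_gt0.
(* Rescaling places the closed unit cube inside [U], with its centre at [x]. *)
pose g u := f (x + (e / 2) *: u).
have cg : continuous g.
  move=> u; have cZ := @continuousZ R _ _ (cst (e / 2)) id u (@cst_continuous _ _ _ u) cvg_id.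
  exact: (continuous_comp (continuousD (@cst_continuous _ _ x u) cZ) (cf _)).
have gI : injective g.
  by move=> u w /fI/addrI/scalerI; apply; rewrite gt_eqF.
have := image_cube_nbhs cg gI; rewrite {1}/g scaler0 addr0.
apply: filterS => _ [u /= u1 <-]; exists (x + (e / 2) *: u) => //.
apply: He; rewrite -ball_normE /= opprD addNKr normrN normrZ gtr0_norm//.
apply: le_lt_trans (_ : e / 2 < e); last by rewrite ltr_pdivrMr//; lra.
by rewrite -[leRHS]mulr1 ler_pM2l.
Qed.

End InvarianceOfDomain.

(** * Finite-time stability and Lyapunov functions *)

Lemma closed_Omegafwd (R : realType) (n : nat) (f : nat -> 'rV[R]_n -> 'rV[R]_n)
    (Omegatr : nat -> set 'rV[R]_n) (k : nat) : continuous (f k) ->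
  bounded_set (Omegatr k) -> open (Omegatr k.+1) -> closed (Omegafwd f Omegatr k).
Proof.
move=> cf [M [Mr HM]] oO.
have cK : compact (closure (Omegatr k)).
  apply: bounded_closed_compact; last exact: closed_closure.
  exists M; split => // M' MM'.
  have /closure_id clB : closed [set x : 'rV[R]_n | `|x| <= M'].
    apply: (@preimage_closed _ _ (fun x : 'rV[R]_n => `|x|) [set t : R | t <= M']).
      by move=> x _; exact: norm_continuous.
    exact: closed_le.
  have /closure_subset : Omegatr k `<=` [set x : 'rV[R]_n | `|x| <= M'] by exact: HM.
  by rewrite -clB.
have clK : closed (f k @` closure (Omegatr k)).
  apply: compact_closed; first exact: norm_hausdorff.
  by apply: continuous_compact => //; exact: continuous_subspaceT.
apply: closedU; first by apply: closedI => //; exact: open_closedC.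
apply: closedI; first exact: closed_closure.
by apply: open_closedC; exact: open_interior.
Qed.

Lemma lyapunov_stable (R : realType) (T : topologicalType) (f : nat -> T -> T)
    (Omega0 : set T) (Omegatr : nat -> set T) (N : nat) (V : nat -> T -> R) :
  Omega0 `<=` Omegatr 0%N -> lyapunov_conditions f Omega0 Omegatr N V ->
  finite_time_stable f Omega0 Omegatr N.
Proof.
move=> O0 [_ dV0 supinf] x xS x0 k kN.
suff [] : Omegatr k (x k) /\ V k (x k) <= V 0%N (x 0%N) by [].
elim: k kN => [|k IH] kN; first by split; [exact: O0|].
have [Ok Vk] := IH (ltnW kN).
have Vk1 : V k.+1 (x k.+1) <= V 0%N (x 0%N).
  by apply: le_trans Vk; rewrite -subr_le0 xS//; exact: dV0.
split=> //; apply: contrapT => nO.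
have : (ereal_inf [set ereal_inf [set (V k.+1 x)%:E | x in Omegafwd f Omegatr k]
                   | k in [set k | (k < N)%N]] <= (V k.+1 (x k.+1))%:E)%E.
  apply: le_trans (ereal_inf_lbound _) (ereal_inf_lbound _); first by exists k.
  exists (x k.+1) => //; left; split => //.
  by exists (x k) => //; [exact: subset_closure | rewrite xS].
apply/negP; rewrite -ltNge; apply: le_lt_trans supinf.
apply: (@le_trans _ _ (V 0%N (x 0%N))%:E); first by rewrite lee_fin.
by apply: ereal_sup_ubound; exists (x 0%N).
Qed.

Fixpoint flow (T : Type) (f : nat -> T -> T) (k : nat) (x : T) : T :=
  if k is k'.+1 then f k' (flow f k' x) else x.

Fixpoint backflow (T : Type) (g : nat -> T -> T) (k : nat) (x : T) : T :=
  if k is k'.+1 then backflow g k' (g k' x) else x.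

Lemma flow_continuous (T : topologicalType) (f : nat -> T -> T) (N : nat) :
  (forall k, (k <= N)%N -> continuous (f k)) ->
  forall k, (k <= N)%N -> continuous (flow f k).
Proof.
move=> cf; elim=> [|k IH] kN x; first exact: cvg_id.
have kN' := ltnW kN.
exact: (continuous_comp (IH kN' x) (cf k kN' (flow f k x))).
Qed.

Lemma backflow_continuous (T : topologicalType) (g : nat -> T -> T) (N : nat) :
  (forall k, (k <= N)%N -> continuous (g k)) ->
  forall k, (k <= N)%N -> continuous (backflow g k).
Proof.
move=> cg; elim=> [|k IH] kN x; first exact: cvg_id.
have kN' := ltnW kN.
exact: (continuous_comp (cg k kN' x) (IH kN' (g k x))).
Qed.

Lemma backflowK (T : Type) (f g : nat -> T -> T) (N : nat) :
  (forall k, (k <= N)%N -> cancel (g k) (f k)) ->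
  forall k, (k <= N)%N -> cancel (backflow g k) (flow f k).
Proof.
move=> gK; elim=> [//|k IH] kN x /=.
by rewrite IH ?(ltnW kN)// gK// ltnW.
Qed.

(** Preimages under [g] are images under [f], so this is invariance of domain. *)
Lemma inverse_continuous (R : realType) (n : nat) (f g : 'rV[R]_n -> 'rV[R]_n) :
  continuous f -> cancel f g -> cancel g f -> continuous g.
Proof.
move=> cf fK gK; apply/continuousP => U oU.
suff -> : g @^-1` U = f @` U by exact: invariance_of_domain (can_inj fK) _ oU.
apply/seteqP; split => [y Uy|_ [x Ux <-]] /=; last by rewrite fK.
by exists (g y).
Qed.

Theorem theorem2 (R : realType) (n N : nat) (N_ge1 : (1 <= N)%N)
    (f : nat -> 'rV[R]_n -> 'rV[R]_n)
    (Omega0 : set 'rV[R]_n) (Omegatr : nat -> set 'rV[R]_n)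
    (Omega0_closed : closed Omega0)
    (Omega0_connected : connected Omega0)
    (Omega0_bounded : bounded_set Omega0)
    (Omegatr_open : forall k, (k <= N)%N -> open (Omegatr k))
    (Omegatr_connected : forall k, (k <= N)%N -> connected (Omegatr k))
    (Omegatr_bounded : forall k, (k <= N)%N -> bounded_set (Omegatr k))
    (Omega0_sub : Omega0 `<=` Omegatr 0%N) :
  ((exists V : nat -> 'rV[R]_n -> R,
      lyapunov_conditions f Omega0 Omegatr N V) ->
   finite_time_stable f Omega0 Omegatr N)
  /\
  ((forall k, (k <= N)%N -> continuous (f k) /\ bijective (f k)) ->
   finite_time_stable f Omega0 Omegatr N ->
   exists V : nat -> 'rV[R]_n -> R,
     lyapunov_conditions f Omega0 Omegatr N V).
Proof.
split=> [[V lV]|fcb fts]; first exact: lyapunov_stable lV.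
have cf k (kN : (k <= N)%N) : continuous (f k) by case: (fcb k kN).
have /choice[g Hg] : forall k, exists g : 'rV[R]_n -> 'rV[R]_n,
    (k <= N)%N -> cancel (f k) g /\ cancel g (f k).
  (* Beyond time [N], where no inverse is given, [g k] is the dummy value [id]. *)
  move=> k; have [kN|] := boolP (k <= N)%N; last by exists id.
  by have [_ [g fK gK]] := fcb k kN; exists g.
have fK k (kN : (k <= N)%N) : cancel (f k) (g k) by case: (Hg k kN).
have gK k (kN : (k <= N)%N) : cancel (g k) (f k) by case: (Hg k kN).
have cg k (kN : (k <= N)%N) : continuous (g k).
  exact: inverse_continuous (cf k kN) (fK k kN) (gK k kN).
have flow_tr x k : Omega0 x -> (k <= N)%N -> Omegatr k (flow f k x).
  by move=> xO0; apply: (fts (fun k => flow f k x)).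
(* Initial states whose trajectory meets [Omegafwd f Omegatr k] at time [k.+1] for some [k < N]; a
   finite union of closed sets. *)
pose C := \bigcup_(k in [set k | (k < N)%N]) flow f k.+1 @^-1` Omegafwd f Omegatr k.
have clC : closed C.
  apply: closed_bigcup => [|k /= kN]; first exact: finite_II.
  apply: preimage_closed; first by move=> x _; apply: flow_continuous kN x.
  apply: closed_Omegafwd; first exact/cf/ltnW.
    exact/Omegatr_bounded/ltnW.
  exact: Omegatr_open.
have disj : Omega0 `&` C = set0.
  rewrite -subset0 => x [xO0 [k /= kN [[_ nO]|[_ nI]]]].
    by apply: nO; exact: (flow_tr x k.+1).
  have oK : open (f k @` Omegatr k).
    apply: invariance_of_domain (cf k (ltnW kN)) (can_inj (fK k (ltnW kN))) _ _.
    exact/Omegatr_open/ltnW.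
  have : f k @` Omegatr k `<=` (f k @` closure (Omegatr k))°.
    by rewrite -open_subsetE//; apply: image_subset; exact: subset_closure.
  move=> KI; apply: nI; apply: KI; exists (flow f k x) => //.
  by apply: flow_tr => //; exact: ltnW.
have /(@uniform_separatorP _ R)[V0 [cV0 _ V00 V01]] :=
  (@normal_separatorP R _).1 pseudometric_normal _ _ Omega0_closed clC disj.
exists (fun k => V0 \o backflow g k); split.
- move=> k kN x; have cb : continuous (backflow g k) by exact: backflow_continuous kN.
  exact: (continuous_comp (cb x) (cV0 _)).
- by move=> k x kN _; rewrite /dV /= fK ?subrr// ltnW.
(* The supremum is at most 0 and the infimum at least 1; these bounds also cover empty sets. *)
- apply: (@le_lt_trans _ _ 0%E).
    by apply: ge_ereal_sup => _ [x xO0 <-]; rewrite lee_fin /= (V00 (V0 x))//; exists x.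
  apply: (@lt_le_trans _ _ 1%E); first by rewrite lte_fin.
  apply: le_ereal_inf_tmp => _ [k /= kN <-]; apply: le_ereal_inf_tmp => _ [x Ox <-].
  rewrite lee_fin [V0 _](V01 _)//; exists (backflow g k.+1 x) => //.
  by rewrite -(backflowK gK kN x) in Ox; exists k.
Qed.
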